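(* Let $\boldsymbol T=(T_1,\ldots,T_n)$ be a left-inverse commuting tuple of operators on a complex Hilbert space $\mathcal H$. Then $\boldsymbol T$ has the individual wandering subspace property if and only if $\boldsymbol T$ has the joint wandering subspace property. Moreover, in this case, $\mathcal W=\bigcap_{i=1}^n\ker T_i^*$ is the corresponding generating wandering subspace for $\boldsymbol T$ on $\mathcal H$.
   Context: All operators are bounded and linear. A tuple $(T_1,\ldots,T_n)$ of commuting left invertible operators on $\mathcal H$ is a left-inverse commuting tuple if $L_iT_j=T_jL_i$ for all $1\le i\ne j\le n$, where $L_j:=(T_j^*T_j)^{-1}T_j^*$ (a left inverse of $T_j$ with $\ker L_j=\ker T_j^*$). For a commuting tuple $\boldsymbol T=(T_1,\ldots,T_n)$ (including $n=1$), a closed subspace $\mathcal W\subseteq\mathcal H$ is a wandering subspace of $\boldsymbol T$ if $\mathcal W\perp T_1^{k_1}\cdots T_n^{k_n}\mathcal W$ for all non-zero $(k_1,\ldots,k_n)\in\mathbb Z_{\ge0}^n$; it is a generating wandering subspace if in addition $\mathcal H=\overline{\mathrm{span}}\{T_1^{k_1}\cdots T_n^{k_n}\mathcal W:(k_1,\ldots,k_n)\in\mathbb Z^n_{\ge 0}\}$. The tuple $\boldsymbol T$ has the joint wandering subspace property if $\boldsymbol T$ has a generating wandering subspace; it has the individual wandering subspace property if each single operator $T_i$, $i=1,\ldots,n$, has a generating wandering subspace. *)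

(* Defs.v *)
From HB Require Import structures.
From mathcomp Require Import all_boot all_order all_algebra.
From mathcomp Require Import complex.
From mathcomp Require Import mathcomp_extra boolp classical_sets functions.
From mathcomp Require Import reals topology normedtype.
Set Implicit Arguments.
Unset Strict Implicit.
Unset Printing Implicit Defensive.
Import Order.TTheory GRing.Theory Num.Theory.
Import numFieldNormedType.Exports.
Local Open Scope classical_set_scope.
Local Open Scope ring_scope.
Local Open Scope complex_scope.

HB.mixin Record isHilbert (R : realType) H of CompleteNormedModule R[i] H := {
  inner : {dot H for @Num.conj R[i]};
  inner_norm : forall x : H, `|x| ^+ 2 = inner x x
}.

(* Complex Hilbert spaces: the scalars are R[i], and the inner product is
   linear in its first argument and conjugate-linear in the second. *)
#[short(type="hilbertType")]
HB.structure Definition Hilbert (R : realType) :=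
  {H of isHilbert R H & CompleteNormedModule R[i] H}.

Section Operators.
Context {R : realType} {H : hilbertType R}.

Local Notation "<< x , y >>" := (@inner R H x y).

Definition bounded_op (T : {linear H -> H}) : Prop :=
  bounded_near T (nbhs (0 : H)).

Definition left_invertible (T : {linear H -> H}) : Prop :=
  exists S : {linear H -> H}, bounded_op S /\ cancel T S.

(* For T bounded, the vector selected here exists by the Riesz representation
   theorem and is unique because the inner product is definite. *)
Definition adjoint (T : H -> H) (y : H) : H :=
  get [set z : H | forall x, << T x, y >> = << x, z >>].

Definition op_ker (T : H -> H) : set H := T @^-1` [set 0].

(* (T^* T)^{-1} T^*; when T is left invertible, T^* T is a bijection of H and
   its pinv over [set: H] is its inverse. *)
Definition left_inv (T : H -> H) : H -> H :=
  pinv [set: H] (adjoint T \o T) \o adjoint T.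

Definition linear_subspace (W : set H) : Prop := submod_closed [in W].

Definition closed_subspace (W : set H) : Prop := linear_subspace W /\ closed W.

Definition linear_span (A : set H) : set H := smallest linear_subspace A.

Definition orthogonal_sets (A B : set H) : Prop :=
  forall x y, A x -> B y -> << x, y >> = 0.

Section Tuples.
Context {n : nat}.
Implicit Types (T : 'I_n -> {linear H -> H}) (k : 'I_n -> nat) (W : set H).

(* T_1^{k_1} \o ... \o T_n^{k_n} *)
Definition monomial T k : H -> H :=
  \big[comp/idfun]_(i < n) iter (k i) (T i).

Definition left_inverse_commuting T : Prop :=
  [/\ forall i, bounded_op (T i),
      forall i, left_invertible (T i),
      forall i j, T i \o T j = T j \o T i &
      forall i j, i != j -> left_inv (T i) \o T j = T j \o left_inv (T i)].

Definition wandering T W : Prop :=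
  closed_subspace W /\
  forall k, (exists i, k i != 0%N) -> orthogonal_sets W (monomial T k @` W).

Definition generating_wandering T W : Prop :=
  wandering T W /\
  closure (linear_span (\bigcup_k (monomial T k @` W))) = [set: H].

Definition joint_wandering_property T : Prop :=
  exists W, generating_wandering T W.

End Tuples.

Definition individual_wandering_property n (T : 'I_n -> {linear H -> H}) : Prop :=
  forall i, joint_wandering_property (fun _ : 'I_1 => T i).

End Operators.

(* Main.v *)
From HB Require Import structures.
Require Import Defs.
From mathcomp Require Import all_boot all_order all_algebra.
From mathcomp Require Import ring complex.
From mathcomp Require Import boolp classical_sets functions.
From mathcomp Require Import reals topology normedtype.
Set Implicit Arguments.
Unset Strict Implicit.
Unset Printing Implicit Defensive.
Import Order.TTheory GRing.Theory Num.Theory.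
Import numFieldNormedType.Exports.
Local Open Scope classical_set_scope.
Local Open Scope ring_scope.

(* A wandering subspace V of a commuting tuple is orthogonal to the range of
   every T_i, and generation splits each vector, up to epsilon, into an element
   of V plus a sum of elements of these ranges; by Pythagoras a vector of
   W = \bigcap_i ker T_i^* is then a limit of elements of V, so V = W. Hence
   both properties only say that the candidate kernels generate.
   Let P_i = I - T_i L_i be the orthogonal projection onto ker T_i^*.
   Left-inverse commutation makes P_i commute with T_j for j <> i.
   Joint => individual: the closed span of all T_i^k ker T_i^* contains W and is
   invariant under all T_j.
   Individual => joint: let G be the closed span of the T^k W. The product of all
   P_i maps H into W, a part of G, and the factors can be dropped one at a time:
   if Q P_i maps H into G, where Q is a product of other P_j's, then Q maps each
   T_i^k v with v = P_i v in ker T_i^* to T_i^k Q P_i v, again in G, and these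
   vectors span a dense subspace. *)

(** The order on [R[i]] is only partial, so the infimum is taken in [R] over the real parts and
    embedded back; [x0] makes the range non-empty. *)
Lemma complex_inf (R : realType) (X : Type) (x0 : X) (f : X -> R[i]) (m : R[i]) :
  (forall x, f x \is Num.real) -> m \is Num.real -> (forall x, m <= f x) ->
  exists d, [/\ d \is Num.real, forall x, d <= f x &
    forall e, 0 < e -> exists x, f x < d + e].
Proof.
move=> fR mR mf; pose S := range (fun x => complex.Re (f x)).
have fE x : f x = (complex.Re (f x))%:C%C by rewrite RRe_real.
have hS : has_inf S.
  split; first by exists (complex.Re (f x0)), x0.
  exists (complex.Re m) => _ [x _ <-].
  by rewrite -lecR -fE RRe_real.
exists (inf S)%:C%C; split.
- by apply/complex_realP; exists (inf S).
- by move=> x; rewrite fE lecR; apply: ge_inf; [exact: hS.2|exists x].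
- move=> e e0; have eE : e = (complex.Re e)%:C%C by rewrite RRe_real// gtr0_real.
  have : 0 < complex.Re e by move: e0; rewrite {1}eE -[0]/(0%:C)%C ltcR.
  move=> /inf_adherent - /(_ _ hS)[_ [x _ <-] ltx].
  by exists x; rewrite fE eE -rmorphD/= ltcR.
Qed.

(** * Inner product identities and Cauchy-Schwarz *)

Section Hilbert.
Context {R : realType} {H : hilbertType R}.
Local Notation C := R[i].

(* Several [Dot] and [Bilinear] coercion paths lead to [inner]; a plain function
   avoids rewriting failures between them. *)
Definition ip (x y : H) : C := @inner R H x y.

Local Notation "<< x , y >>" := (ip x y).

Lemma ipC (x y : H) : << x, y >> = << y, x >>^*.
Proof. by rewrite /ip hermC expr0 mul1r. Qed.

Lemma ipDl (x y z : H) : << x + y, z >> = << x, z >> + << y, z >>.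
Proof. exact: (linearDl inner z x y). Qed.

Lemma ipDr (x y z : H) : << x, y + z >> = << x, y >> + << x, z >>.
Proof. exact: (linearDr inner x y z). Qed.

Lemma ipBr (x y z : H) : << x, y - z >> = << x, y >> - << x, z >>.
Proof. exact: (linearBr inner x y z). Qed.

Lemma ip0l (x : H) : << 0, x >> = 0.
Proof. exact: (linear0l inner x). Qed.

Lemma ip0r (x : H) : << x, 0 >> = 0.
Proof. exact: (linear0r inner x). Qed.

Lemma ipZl (a : C) (x y : H) : << a *: x, y >> = a * << x, y >>.
Proof. exact: (linearZl_LR inner y a x). Qed.

Lemma ipZr (a : C) (x y : H) : << x, a *: y >> = a^* * << x, y >>.
Proof. exact: (linearZr_LR inner x a y). Qed.

Lemma ip_norm (x : H) : << x, x >> = `|x| ^+ 2.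
Proof. by rewrite inner_norm. Qed.

Lemma ip_ge0 (x : H) : 0 <= << x, x >>.
Proof. by rewrite ip_norm exprn_ge0. Qed.

Lemma ip_eq0 (x : H) : << x, x >> = 0 -> x = 0.
Proof. by rewrite ip_norm => /eqP; rewrite sqrf_eq0 normr_eq0 => /eqP. Qed.

Lemma ip_eq0C (x y : H) : << x, y >> = 0 -> << y, x >> = 0.
Proof. by move=> xy; rewrite ipC xy conjC0. Qed.

Lemma ip_ext (y z : H) : (forall x, << x, y >> = << x, z >>) -> y = z.
Proof.
by move=> h; apply/subr0_eq/ip_eq0; rewrite ipBr h subrr.
Qed.

Lemma normD_orthogonal (x y : H) : << x, y >> = 0 ->
  `|x + y| ^+ 2 = `|x| ^+ 2 + `|y| ^+ 2.
Proof.
move=> xy; have yx := ip_eq0C xy.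
by rewrite -!ip_norm ipDl !ipDr xy yx addr0 add0r.
Qed.

(* The hypothesis is used at the minimiser [t = - a^* / q]. *)
Lemma real_quadratic_discriminant (a e q : C) : 0 <= q -> (q = 0 -> a = 0) ->
  (forall t, - e <= `|t| ^+ 2 * q + (t * a + (t * a)^*)) ->
  `|a| ^+ 2 <= e * q.
Proof.
move=> q0 qa h; have [q00|qn0] := eqVneq q 0.
  by rewrite (qa q00) normr0 q00 expr0n mulr0.
have qp : 0 < q by rewrite lt_def qn0.
have qc : q^* = q by apply: conj_Creal; rewrite ger0_real.
pose r := `|a| ^+ 2 / q.
have ta : - (a^* / q) * a = - r by rewrite mulNr mulrAC -normCKC.
have rR : r^* = r.
  by apply: conj_Creal; rewrite ger0_real// divr_ge0// exprn_ge0.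
have := h (- (a^* / q)); rewrite ta rmorphN/= rR.
rewrite normrN normrM normfV norm_conjC (gtr0_norm qp).
rewrite (_ : _ + _ = - r); last by rewrite /r; field.
by rewrite lerN2 ler_pdivrMr.
Qed.

(** Positivity of [<< t *: x + y, t *: x + y >>] for all [t] is a quadratic inequality in [t], to
    which the discriminant bound applies. *)
Lemma ip_CauchySchwarz (x y : H) : `|<< x, y >>| <= `|x| * `|y|.
Proof.
rewrite -(@ler_pXn2r _ 2) ?nnegrE ?mulr_ge0// exprMn mulrC.
rewrite -!ip_norm; apply: real_quadratic_discriminant.
- exact: ip_ge0.
- by move=> /ip_eq0 ->; rewrite ip0l.
move=> t; rewrite lerNl -subr_ge0 opprK.
rewrite (_ : _ + _ = << t *: x + y, t *: x + y >>) ?ip_ge0//.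
rewrite ipDl !ipDr !ipZl !ipZr (ipC y x) rmorphM normCK.
ring.
Qed.

(** * Operator bounds and small-epsilon estimates *)

Definition bounded_below (T : H -> H) :=
  exists2 c : C, 0 <= c & forall x, `|x| <= c * `|T x|.

Lemma bounded_opP (T : {linear H -> H}) : bounded_op T ->
  exists2 M : C, 0 <= M & forall x, `|T x| <= M * `|x|.
Proof.
move=> /linear_boundedP [M [MR h]]; exists (`|M| + 1) => [|x].
  by rewrite addr_ge0.
apply: h; rewrite -(@ger0_norm _ (`|M| + 1)) ?addr_ge0//.
by rewrite ger0_norm ?addr_ge0// (le_lt_trans (real_ler_norm MR))// ltrDl.
Qed.

Lemma left_invertible_bounded_below (T : {linear H -> H}) :
  left_invertible T -> bounded_below T.
Proof.
by move=> [S [/bounded_opP[M M0 SM] TK]]; exists M => // x; rewrite -{1}(TK x).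
Qed.

Lemma ge0_le_small (x K : C) : 0 <= x -> 0 <= K ->
  (forall e, 0 < e -> e <= 1 -> x <= K * e) -> x = 0.
Proof.
move=> x0 K0 h; apply/eqP; apply: contraT => xn0.
have xp : 0 < x by rewrite lt_def xn0.
have sp : 0 < x + K + 1 by rewrite ltr_wpDl// addr_ge0.
(* This [e] lies in (0, 1], and cancelling [x] leaves the contradiction [x + K + 1 <= K]. *)
have := h (x / (x + K + 1)); rewrite divr_gt0// => /(_ isT).
rewrite ler_pdivrMr// mul1r -{1}[x]addr0 -addrA lerD2l addr_ge0// => /(_ isT).
rewrite mulrCA -[X in X <= _]mulr1 ler_pM2l// addrA ler_pdivlMr// mul1r.
rewrite addrAC gerDr => /(lt_le_trans (ltr_wpDr ler01 xp)).
by rewrite ltxx.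
Qed.

Lemma norm_le_linear_eq0 (x K : C) : 0 <= K ->
  (forall e, 0 < e -> e <= 1 -> `|x| ^+ 2 <= K * e) -> x = 0.
Proof.
move=> K0 /ge0_le_small - /(_ (exprn_ge0 _ (normr_ge0 _)) K0) /eqP.
by rewrite sqrf_eq0 normr_eq0 => /eqP.
Qed.

Lemma sqr_normD_le (x y : C) : `|x + y| ^+ 2 <= 2 * (`|x| ^+ 2 + `|y| ^+ 2).
Proof.
apply: (@le_trans _ _ ((`|x| + `|y|) ^+ 2)).
  by rewrite ler_pXn2r ?nnegrE ?addr_ge0// ler_normD.
rewrite -subr_ge0 (_ : _ - _ = (`|x| - `|y|) ^+ 2); last by ring.
by apply: real_exprn_even_ge0 => //; rewrite rpredB ?normr_real.
Qed.

(** * A variational representation theorem *)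

Section Minimisation.
Variables (T S : {linear H -> H}) (y : H).
Hypotheses (Tb : bounded_op T) (Tbb : bounded_below T) (Sb : bounded_op S).

Let phi (x : H) : C := << T x, T x >> - (<< S x, y >> + << S x, y >>^*).
(** Half of the first variation: [phi (x + t *: u)] has first-order part 2 Re (t [grad x u]). *)
Let grad (x u : H) : C := << T u, T x >> - << S u, y >>.

Let phi_real x : phi x \is Num.real.
Proof.
rewrite /phi rpredB//; first by rewrite ger0_real// ip_ge0.
by apply/CrealP; rewrite rmorphD/= conjCK addrC.
Qed.

Let phi_move x u t :
  phi (x + t *: u) = phi x +
    (`|t| ^+ 2 * << T u, T u >> + (t * grad x u + (t * grad x u)^*)).
Proof.
rewrite /phi /grad !linearD !linearZ/= !(ipDl, ipDr, ipZl, ipZr).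
rewrite (ipC (T x) (T u)) !(rmorphM, rmorphD, rmorphB, rmorphN)/= normCK.
by ring.
Qed.

(** Bounds on [S] and below on [T] give |S x| <= M c |T x|, so [phi x] >= |T x|^2 - 2 b |T x|, and
    completing the square gives -b^2. *)
Let phi_bounded_below : exists2 m, m \is Num.real & forall x, m <= phi x.
Proof.
have [c c0 cT] := Tbb; have [M M0 SM] := bounded_opP Sb.
pose b := M * c * `|y|.
exists (- b ^+ 2).
  by rewrite rpredN rpredX// !rpredM ?normr_real// ger0_real.
move=> x; rewrite /phi.
have Sxy : `|<< S x, y >>| <= b * `|T x|.
  apply: (le_trans (ip_CauchySchwarz _ _)).
  rewrite /b mulrAC ler_wpM2r//; apply: (le_trans (SM x)).
  by rewrite -mulrA ler_wpM2l.
have ReS : << S x, y >> + << S x, y >>^* <= 2 * (b * `|T x|).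
  have := (leif_Re_Creal << S x, y >>).1; rewrite ReE.
  rewrite ler_pdivrMr// mulrC => /le_trans; apply.
  by rewrite ler_pM2l.
rewrite ip_norm lerBrDr; apply: (le_trans (lerD (lexx _) ReS)).
rewrite -subr_ge0 (_ : _ - _ = (`|T x| - b) ^+ 2); last by ring.
by apply: real_exprn_even_ge0 => //; rewrite rpredB ?normr_real//
  !rpredM ?normr_real// ger0_real.
Qed.

(** Moving from a near-minimiser [x] along [u] lowers [phi] by less than [e]; this is the quadratic
    inequality of the discriminant lemma. *)
Let grad_small d e x u : (forall z, d <= phi z) -> phi x < d + e ->
  `|grad x u| ^+ 2 <= e * << T u, T u >>.
Proof.
move=> dphi xe; apply: real_quadratic_discriminant; first exact: ip_ge0.
  move=> /ip_eq0 Tu0; have [c c0 cT] := Tbb.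
  have /eqP : `|u| = 0.
    by apply/eqP; rewrite eq_le normr_ge0 (le_trans (cT u))// Tu0 normr0 mulr0.
  by rewrite normr_eq0 => /eqP ->; rewrite /grad !linear0 !ip0l subrr.
move=> t; have := dphi (x + t *: u); rewrite phi_move => h.
rewrite lerNl -subr_ge0 opprK.
have : 0 <= (phi x + (`|t| ^+ 2 * << T u, T u >> +
  (t * grad x u + (t * grad x u)^*)) - d) + (d + e - phi x).
  by rewrite addr_ge0 ?subr_ge0// ltW.
by congr (0 <= _); ring.
Qed.

(* For [T = id] this is Riesz representation. The vector [z] minimises [phi];
   near-minimality bounds the gradient [grad x], and since
   [grad x1 (x1 - x2) - grad x2 (x1 - x2) = |T (x1 - x2)|^2], it also makes
   minimising sequences Cauchy. *)
Lemma ip_representation : exists z, forall u, << T u, T z >> = << S u, y >>.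
Proof.
have [m mR mphi] := phi_bounded_below.
have [d [dR dphi dinf]] := complex_inf 0 phi_real mR mphi.
have [c c0 cT] := Tbb; have [M M0 TM] := bounded_opP Tb.
pose A e := [set x | phi x < d + e].
(* Real thresholds are comparable, so the sublevel sets [A e] are nested and form a filter base. *)
pose F := filter_from [set e : C | 0 < e] A.
have FF : ProperFilter F.
  apply: filter_from_proper => [|e /dinf[x xe]]; last by exists x.
  apply: filter_from_filter; first by exists 1; apply: ltr01.
  move=> e1 e2 /= e10 e20.
  have /orP[le|le] := real_leVge (gtr0_real e10) (gtr0_real e20).
  - exists e1 => // x /= xe; split => //=.
    by apply: (lt_le_trans xe); rewrite lerD2l.
  - exists e2 => // x /= xe; split => //=.
    by apply: (lt_le_trans xe); rewrite lerD2l.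
have AA e x1 x2 : 0 < e -> A e x1 -> A e x2 ->
  `|x1 - x2| ^+ 2 <= c ^+ 2 * (4 * e).
  move=> e0 /(grad_small (x1 - x2) dphi) h1 /(grad_small (x1 - x2) dphi) h2.
  apply: (@le_trans _ _ ((c * `|T (x1 - x2)|) ^+ 2)).
    by rewrite ler_pXn2r ?nnegrE ?mulr_ge0.
  rewrite exprMn ler_wpM2l ?exprn_ge0// -ip_norm.
  set q := << _, _ >> in h1 h2 *.
  have q0 : 0 <= q by apply: ip_ge0.
  have gq : grad x1 (x1 - x2) - grad x2 (x1 - x2) = q.
    rewrite (_ : q = << T (x1 - x2), T x1 >> - << T (x1 - x2), T x2 >>).
      by rewrite /grad; ring.
    by rewrite -ipBr -linearB.
  (* Both gradients satisfy |grad|^2 <= e q and their difference is q, so q^2 <= 4 e q, where q is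
     cancelled unless it vanishes. *)
  have := sqr_normD_le (grad x1 (x1 - x2)) (- grad x2 (x1 - x2)).
  rewrite gq normrN ger0_norm// => /le_trans - /(_ (2 * (e * q + e * q))).
  rewrite ler_pM2l// lerD// => /(_ isT).
  have [->|qn0] := eqVneq q 0; first by rewrite mulr_ge0// ltW.
  have qp : 0 < q by rewrite lt_def qn0.
  rewrite (_ : 2 * _ = (4 * e) * q); last by ring.
  by rewrite expr2 ler_pM2r.
have /cauchy_cvg : cauchy F.
  apply/cauchy_exP => e e0.
  (* The summand 1 keeps [K] positive when [c = 0] and makes the final inequality strict. *)
  pose K := c ^+ 2 * 4 + 1.
  have Kp : 0 < K by rewrite ltr_wpDl// mulr_ge0// exprn_ge0.
  pose e' := e ^+ 2 / K.
  have e'0 : 0 < e' by rewrite divr_gt0// exprn_gt0.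
  have [x xe] := dinf _ e'0.
  exists x; exists e' => // x2 x2e; rewrite -ball_normE/=.
  rewrite -(@ltr_pXn2r _ 2) ?nnegrE ?(ltW e0)//.
  apply: (le_lt_trans (AA _ _ _ e'0 xe x2e)).
  rewrite mulrA /e' mulrA ltr_pdivrMr// mulrC ltr_pM2l ?exprn_gt0//.
  by rewrite ltrDl.
rewrite cvg_ex /= => -[z Fz].
exists z => u; apply/eqP; rewrite -subr_eq0; apply/eqP.
pose Q := << T u, T u >>.
(* The defect at [z] is the gradient at a near-minimiser [x], of square at most Q e, plus
   [<< T u, T (z - x) >>], of square at most Q M^2 e^2 <= Q M^2 e. *)
apply: (@norm_le_linear_eq0 _ (2 * (Q * (1 + M ^+ 2)))).
  by rewrite !mulr_ge0 ?ip_ge0// addr_ge0// exprn_ge0.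
move=> e e0 e1.
have [x [Ax zx]] : exists x, A e x /\ `|z - x| < e.
  have Fe : F (A e) by exists e.
  have Fb : F (ball z e) by apply: Fz; apply: nbhsx_ballx.
  have [x [xA xb]] := filter_ex (filterI Fe Fb).
  by exists x; split => //; move: xb; rewrite -ball_normE.
rewrite (_ : _ - _ = grad x u + << T u, T (z - x) >>); last first.
  by rewrite [T (z - x)]linearB ipBr /grad; ring.
apply: (le_trans (sqr_normD_le _ _)).
rewrite -mulrA ler_pM2l// mulrDr mulr1 mulrDl lerD//.
  by rewrite [Q * e]mulrC; apply: grad_small Ax.
apply: (@le_trans _ _ ((`|T u| * (M * e)) ^+ 2)).
  rewrite ler_pXn2r ?nnegrE ?mulr_ge0// ?(ltW e0)//.
  apply: (le_trans (ip_CauchySchwarz _ _)).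
  rewrite ler_wpM2l//; apply: (le_trans (TM _)).
  by rewrite ler_wpM2l// ltW.
rewrite !exprMn -ip_norm -/Q -mulrA ler_wpM2l ?ip_ge0//.
rewrite ler_wpM2l ?exprn_ge0// expr2.
by rewrite -[leRHS]mulr1 ler_wpM2l// ltW.
Qed.

End Minimisation.

(** * Closed subspaces and closed spans *)

Lemma linear_subspaceP (A : set H) : linear_subspace A <->
  A 0 /\ forall a u v, A u -> A v -> A (a *: u + v).
Proof.
split=> -[A0 AP]; split; first exact: set_mem A0.
- by move=> a u v Au Av; apply: set_mem; apply: AP; apply/mem_set.
- by apply/mem_set.
- by move=> a u v /set_mem Au /set_mem Av; apply/mem_set; apply: AP.
Qed.

Lemma closed_subspaceP (A : set H) : closed_subspace A <->
  [/\ A 0, forall a u v, A u -> A v -> A (a *: u + v) & closed A].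
Proof.
by split=> [[/linear_subspaceP[? ?]]|[? ? ?]]//; split=> //; apply/linear_subspaceP.
Qed.

Lemma closed_subspace_preimage (f : H -> H) (K : set H) :
  linear f -> continuous f -> closed_subspace K -> closed_subspace (f @^-1` K).
Proof.
move=> fl fc /closed_subspaceP[K0 KP Kc]; apply/closed_subspaceP; split => /=.
- have := fl (-1) 0 0; rewrite scaler0 addr0 scaleN1r addNr => ->.
  exact: K0.
- by move=> a u v Ku Kv; rewrite fl; apply: KP.
- exact: (continuous_closedP _).1 Kc.
Qed.

Lemma linear_subspace_span (A : set H) : linear_subspace (linear_span A).
Proof.
apply/linear_subspaceP; split=> [B [/linear_subspaceP[]]//|a u v Au Av B BP].
have [/linear_subspaceP[_ BC] _] := BP.
by apply: BC; [exact: Au|exact: Av].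
Qed.

Lemma closed_subspace_closure (A : set H) :
  linear_subspace A -> closed_subspace (closure A).
Proof.
move=> /linear_subspaceP[A0 AP]; apply/closed_subspaceP.
split; [exact: subset_closure|move=> a|exact: closed_closure].
have cl := @closed_closure H A.
(* The closure is taken in one variable at a time: first in [u] with [v] in [A], then in [v]. *)
have stepr u v : A v -> closure A u -> closure A (a *: u + v).
  move=> Av; suff: closure A `<=` (fun u => a *: u + v) @^-1` closure A by apply.
  rewrite [X in _ `<=` X](closure_id _).1; last first.
    apply: (continuous_closedP _).1 cl => x.
    by apply: cvgD; [exact: scaler_continuous|exact: cvg_cst].
  by apply: closure_subset => w Aw; apply: subset_closure; exact: AP.
move=> u v Au; suff: closure A `<=` (fun v => a *: u + v) @^-1` closure A by apply.
rewrite [X in _ `<=` X](closure_id _).1; last first.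
  apply: (continuous_closedP _).1 cl => x.
  by apply: cvgD; [exact: cvg_cst|exact: cvg_id].
by apply: closure_subset => w Aw; exact: stepr.
Qed.

Lemma closure_span_subset (A K : set H) : closed_subspace K -> A `<=` K ->
  closure (linear_span A) `<=` K.
Proof.
move=> [Kl Kc] AK; rewrite [X in _ `<=` X](closure_id K).1//.
by apply: closure_subset; apply: smallest_sub.
Qed.

Lemma closureP_norm (A : set H) (x : H) :
  closure A x <-> forall e : C, 0 < e -> exists2 a, A a & `|x - a| < e.
Proof.
split=> [Ax e e0|h B /nbhs_ballP[e e0 eB]].
  have [a [Aa]] := Ax _ (nbhsx_ballx x e e0).
  by rewrite -ball_normE; exists a.
by have [a Aa xa] := h e e0; exists a; split=> //; apply: eB; rewrite -ball_normE.
Qed.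

Lemma closed_subspace_orthogonal (w : H) :
  closed_subspace [set x | << x, w >> = 0].
Proof.
apply/closed_subspaceP; split => /=; first by rewrite ip0l.
- by move=> a u v uw vw; rewrite ipDl ipZl uw vw mulr0 addr0.
- move=> x /closureP_norm xA.
  apply: (@norm_le_linear_eq0 _ (`|w| ^+ 2)); first by rewrite exprn_ge0.
  move=> e e0 e1; have [a aw xa] := xA e e0.
  rewrite -[x](subrK a) ipDl aw addr0.
  apply: (@le_trans _ _ ((e * `|w|) ^+ 2)).
    rewrite ler_pXn2r ?nnegrE ?mulr_ge0// ?(ltW e0)//.
    by apply: (le_trans (ip_CauchySchwarz _ _)); rewrite ler_wpM2r// ltW.
  rewrite exprMn mulrC ler_wpM2l ?exprn_ge0//.
  by rewrite expr2 -[leRHS]mulr1 ler_wpM2l// ltW.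
Qed.

(** * Adjoints, left inverses and projections onto adjoint kernels *)

Section Adjoint.
Variable T : {linear H -> H}.
Hypothesis Tb : bounded_op T.

Lemma adjointP (x y : H) : << T x, y >> = << x, adjoint T y >>.
Proof.
suff : [set z : H | forall x, << T x, y >> = << x, z >>] (adjoint T y) by apply.
(* [get] meets its specification once a witness exists; Riesz representation, with the identity as
   first operator, supplies it. *)
apply: getPex; have idb : bounded_op (idfun : {linear H -> H}).
  by apply/linear_bounded_continuous => z; exact: cvg_id.
have idbb : bounded_below (idfun : {linear H -> H}).
  by exists 1 => // z; rewrite mul1r.
have [z zP] := ip_representation y idb idbb Tb.
by exists z => u; exact/esym/zP.
Qed.

Lemma op_ker_adjointP (y : H) :
  op_ker (adjoint T) y <-> forall x, << T x, y >> = 0.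
Proof.
split=> [Ty x|Ty]; first by rewrite adjointP Ty ip0r.
by rewrite /op_ker/=; apply: ip_ext => x; rewrite -adjointP Ty ip0r.
Qed.

Hypothesis Tbb : bounded_below T.

(** These are the normal equations: [T (left_inv T x)] is the orthogonal projection of [x] onto the
    range of [T]. *)
Lemma left_invP (x u : H) : << T u, T (left_inv T x) >> = << T u, x >>.
Proof.
suff E : adjoint T (T (left_inv T x)) = adjoint T x by rewrite !adjointP E.
(* [pinv] inverts only on the image of T^* T; the representation theorem with [S] equal to [T] puts
   [adjoint T x] there. *)
apply: (@pinvK _ _ _ [set: H] (adjoint T \o T)); rewrite inE.
have [z zP] := ip_representation x Tb Tbb Tb.
by exists z => //=; apply: ip_ext => v; rewrite -!adjointP zP.
Qed.

(** T (z - L x) is orthogonal to the range of [T], hence to itself; so it vanishes, and [T] is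
    injective. *)
Lemma left_inv_unique (x z : H) :
  (forall u, << T u, T z >> = << T u, x >>) -> z = left_inv T x.
Proof.
move=> zP; have [c c0 cT] := Tbb; apply/subr0_eq/eqP.
rewrite -normr_eq0 eq_le normr_ge0 andbT (le_trans (cT _))//.
suff -> : T (z - left_inv T x) = 0 by rewrite normr0 mulr0.
by apply: ip_eq0; rewrite {2}linearB ipBr left_invP zP subrr.
Qed.

Lemma left_inv_eq0 (x : H) : left_inv T x = 0 <-> op_ker (adjoint T) x.
Proof.
rewrite op_ker_adjointP; split=> [Lx u|Tx].
  by rewrite -left_invP Lx linear0 ip0r.
by apply/esym/left_inv_unique => u; rewrite linear0 ip0r Tx.
Qed.

Lemma left_inv_linear : linear (left_inv T).
Proof.
move=> a x y; apply/esym/left_inv_unique => u.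
by rewrite linearP !ipDr !ipZr !left_invP.
Qed.

(* The orthogonal projection of [H] onto [op_ker (adjoint T)]. *)
Definition coproj (x : H) : H := x - T (left_inv T x).

Lemma coproj_orthogonal (u x : H) : << T u, coproj x >> = 0.
Proof. by rewrite ipBr left_invP subrr. Qed.

Lemma coproj_ker (x : H) : op_ker (adjoint T) (coproj x).
Proof. by apply/op_ker_adjointP => u; exact: coproj_orthogonal. Qed.

Lemma coproj_id (x : H) : op_ker (adjoint T) x -> coproj x = x.
Proof. by move=> /left_inv_eq0; rewrite /coproj => ->; rewrite linear0 subr0. Qed.

Lemma coproj_linear : linear coproj.
Proof.
move=> a x y; rewrite /coproj left_inv_linear linearP scalerBr opprD.
by rewrite addrACA.
Qed.

(** The image of [coproj] is orthogonal to the range of [T], so both sides equal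
    [<< coproj x, coproj y >>]. *)
Lemma coproj_selfadjoint (x y : H) : << coproj x, y >> = << x, coproj y >>.
Proof.
have h u v : << coproj u, v >> = << coproj u, coproj v >>.
  rewrite [in RHS]/coproj ipBr (ip_eq0C (coproj_orthogonal _ _)).
  by rewrite subr0.
by rewrite h [RHS]ipC [in RHS]h -ipC.
Qed.

Lemma coproj_continuous : continuous coproj.
Proof.
pose P : {linear H -> H} :=
  HB.pack coproj (GRing.isLinear.Build _ _ _ _ coproj coproj_linear).
apply: (linear_bounded_continuous P).1; apply/linear_boundedP.
exists 1; split => // r r1 x; apply: (@le_trans _ _ `|x|); last first.
  by rewrite ler_peMl// ltW.
rewrite -(@ler_pXn2r _ 2) ?nnegrE//=.
(* Pythagoras makes [coproj] a contraction. *)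
suff -> : `|x| ^+ 2 = `|coproj x| ^+ 2 + `|T (left_inv T x)| ^+ 2.
  by rewrite lerDl exprn_ge0.
rewrite -normD_orthogonal ?subrK//.
exact/ip_eq0C/coproj_orthogonal.
Qed.

End Adjoint.

(** * Wandering subspaces of commuting tuples *)

Section Tuple.
Context {n : nat}.
Variable T : 'I_n -> {linear H -> H}.
Hypothesis Tb : forall i, bounded_op (T i).
Hypothesis TC : forall i j, T i \o T j = T j \o T i.

Local Notation W := (\bigcap_i op_ker (adjoint (T i))).

Let TCE i j x : T i (T j x) = T j (T i x).
Proof. by have /(congr1 (@^~ x)) := TC i j. Qed.

Lemma bigcap_op_kerP (x : H) : W x <-> forall i u, << T i u, x >> = 0.
Proof.
split=> [Wx i|Wx i _]; first exact/(op_ker_adjointP (Tb i))/Wx.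
exact/(op_ker_adjointP (Tb i))/Wx.
Qed.

Lemma closed_subspace_bigcap_op_ker : closed_subspace W.
Proof.
(* Written as the orthogonal complement of all ranges, [W] is an intersection of closed
   subspaces. *)
have E : W = \bigcap_(p : 'I_n * H) [set x | << x, T p.1 p.2 >> = 0].
  apply/seteqP; split=> x /=.
    by move=> /bigcap_op_kerP Wx p _; exact/ip_eq0C/Wx.
  by move=> Wx; apply/bigcap_op_kerP => i u; exact/ip_eq0C/(Wx (i, u)).
have cl p := (closed_subspaceP _).1 (closed_subspace_orthogonal (T p.1 p.2)).
rewrite E; apply/closed_subspaceP; split.
- by move=> p _; have [] := cl p.
- by move=> a u v Au Av p _; have [_ + _] := cl p; apply; [exact: Au|exact: Av].
- by apply: closed_bigI => p _; have [] := cl p.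
Qed.

Lemma monomial0 : monomial T (fun=> 0%N) = idfun.
Proof. by rewrite /monomial; elim/big_rec: _ => // i f _ ->. Qed.

Lemma monomialS (i : 'I_n) (k : 'I_n -> nat) (x : H) :
  monomial T (fun j => if j == i then (k j).+1 else k j) x =
  T i (monomial T k x).
Proof.
have iterC j m y : iter m (T j) (T i y) = T i (iter m (T j) y).
  by elim: m => //= m ->; rewrite TCE.
(* Induction on the index list, which contains [i] exactly once: [T i] passes the factors before
   [i], and the exponents after it are unchanged. *)
rewrite /monomial; have := mem_index_enum i; have := index_enum_uniq 'I_n.
elim: (index_enum _) => // j s IH /= /andP[js us].
rewrite inE !big_cons /= => /predU1P[ij|si].
  subst j; rewrite eqxx iterS; congr (T i (iter _ _ _)).
  have : i \notin s by [].
  elim: s {IH js us} => [|j s IH]; first by rewrite !big_nil.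
  rewrite inE negb_or !big_cons /= eq_sym => /andP[/negPf -> /IH ->].
  by [].
have /negPf -> : j != i by apply: contraNneq js => ->.
by rewrite IH// iterC.
Qed.

Lemma monomial_factor (i : 'I_n) (k : 'I_n -> nat) : k i != 0%N ->
  exists k', forall x, monomial T k x = T i (monomial T k' x).
Proof.
move=> ki; exists (fun j => if j == i then (k j).-1 else k j) => x.
rewrite -monomialS; congr (monomial T _ x); apply/funext => j.
by case: eqVneq => // ->; rewrite prednK// lt0n.
Qed.

Lemma wandering_bigcap_op_ker : wandering T W.
Proof.
split=> [|k [i ki] x _ /bigcap_op_kerP Wx [y _ <-]].
  exact: closed_subspace_bigcap_op_ker.
by have [k' ->] := monomial_factor ki; exact/ip_eq0C/Wx.
Qed.

Definition generated (V : set H) : set H :=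
  closure (linear_span (\bigcup_k (monomial T k @` V))).

Lemma closed_subspace_generated (V : set H) : closed_subspace (generated V).
Proof. exact/closed_subspace_closure/linear_subspace_span. Qed.

Lemma generated_monomial (V : set H) (k : 'I_n -> nat) (x : H) :
  V x -> generated V (monomial T k x).
Proof.
by move=> Vx; apply: subset_closure; apply: sub_gen_smallest; exists k => //; exists x.
Qed.

Lemma generated_sub (V : set H) : V `<=` generated V.
Proof.
by move=> x Vx; have := @generated_monomial V (fun=> 0%N) x Vx; rewrite monomial0.
Qed.

(** Together with [generated_invariant], this makes [generated V] the least closed invariant
    subspace containing [V]; it serves as an induction principle. *)
Lemma generated_subset (V K : set H) : closed_subspace K -> V `<=` K ->
  (forall i x, K x -> K (T i x)) -> generated V `<=` K.
Proof.
move=> Kc VK KT; apply: closure_span_subset => // _ [k _ [x /VK Kx <-]].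
rewrite /monomial; elim/big_rec: _ => // i f _ Kf /=.
by elim: (k i) => //= m Km; apply: KT.
Qed.

Lemma bounded_op_continuous i : continuous (T i).
Proof. exact: (linear_bounded_continuous _).1 (Tb i). Qed.

Lemma generated_invariant (V : set H) i : generated V `<=` T i @^-1` generated V.
Proof.
apply: closure_span_subset.
  apply: closed_subspace_preimage; last exact: closed_subspace_generated.
  - exact: linearP.
  - exact: bounded_op_continuous.
move=> _ [k _ [x Vx <-]] /=.
by rewrite -monomialS; apply: generated_monomial.
Qed.

Lemma generating_wandering_unique (V : set H) : generating_wandering T V -> V = W.
Proof.
move=> [[Vc Vorth] Vgen].
have [V0 VP Vcl] := (closed_subspaceP _).1 Vc.
have VW : V `<=` W.
  move=> w Vw; apply/bigcap_op_kerP => i u.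
  (* By density it suffices to test monomials, and [T i] raises an exponent, so the wandering
     condition applies. *)
  suff : generated V `<=` T i @^-1` [set x | << x, w >> = 0].
    by apply; rewrite /generated Vgen.
  apply: closure_span_subset.
    apply: closed_subspace_preimage; last exact: closed_subspace_orthogonal.
    - exact: linearP.
    - exact: bounded_op_continuous.
  move=> _ [k _ [x Vx <-]] /=; rewrite -monomialS; apply: ip_eq0C.
  apply: Vorth => //; last by exists x.
  by exists i; rewrite eqxx.
apply/seteqP; split => // x Wx.
have Wc := (closed_subspaceP _).1 closed_subspace_bigcap_op_ker.
(* [D] is the sum of [V] and the orthogonal complement of [W]; every monomial with a non-zero
   exponent maps into that complement. *)
pose D := [set y | exists v t, [/\ V v, forall z, W z -> << t, z >> = 0 &
  y = v + t]].
have Dl : linear_subspace D.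
  apply/linear_subspaceP; split.
    by exists 0, 0; split=> //; [move=> z _; rewrite ip0l|rewrite addr0].
  move=> a _ _ [v1 [t1 [v1V t1W ->]]] [v2 [t2 [v2V t2W ->]]].
  exists (a *: v1 + v2), (a *: t1 + t2); split; first exact: VP.
    by move=> z Wz; rewrite ipDl ipZl t1W// t2W// mulr0 addr0.
  by rewrite scalerDr addrACA.
have DD : linear_span (\bigcup_k (monomial T k @` V)) `<=` D.
  apply: smallest_sub => // _ [k _ [v Vv <-]].
  have [[i ki]|k0] := pselect (exists i, k i != 0%N).
    have [k' ->] := monomial_factor ki.
    exists 0, (T i (monomial T k' v)); split=> //; last by rewrite add0r.
    by move=> z /bigcap_op_kerP.
  exists v, 0; split=> //; first by move=> z _; rewrite ip0l.
  rewrite addr0 (_ : k = fun=> 0%N) ?monomial0//; apply/funext => i.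
  by apply/eqP; apply: contrapT => /negP ki; apply: k0; exists i.
rewrite (closure_id V).1//.
apply/closureP_norm => e e0.
have : generated V x by rewrite /generated Vgen.
move=> /closureP_norm /(_ e e0)[_ /DD[v [t [Vv tW ->]]] xvt].
exists v => //; apply: le_lt_trans xvt.
(* Since [x - v] lies in [W] and [t] is orthogonal to [W], dropping [t] can only reduce the
   distance. *)
rewrite -(@ler_pXn2r _ 2) ?nnegrE// opprD addrA.
rewrite [leRHS]normD_orthogonal ?lerDl ?exprn_ge0//.
have Wxv : W (x - v).
  by case: Wc => _ WP _; rewrite addrC -scaleN1r; apply: WP => //; exact: VW.
by rewrite ipC -[- t]scaleN1r ipZl tW// mulr0 conjC0.
Qed.

Lemma generating_wandering_bigcapP :
  generating_wandering T W <-> forall x, generated W x.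
Proof.
split=> [[_ Wgen] x|Wgen]; first by rewrite /generated Wgen.
split; first exact: wandering_bigcap_op_ker.
by apply/seteqP; split=> // x _; exact: Wgen.
Qed.

Lemma joint_wandering_propertyP :
  joint_wandering_property T <-> forall x, generated W x.
Proof.
rewrite -generating_wandering_bigcapP; split=> [[V VT]|WT]; last by exists W.
by rewrite -(generating_wandering_unique VT).
Qed.

End Tuple.

(** * The two implications under left-inverse commutation *)

Section LeftInverseCommuting.
Context {n : nat}.
Variable T : 'I_n -> {linear H -> H}.
Hypothesis hT : left_inverse_commuting T.

Local Notation W := (\bigcap_i op_ker (adjoint (T i))).
Local Notation single i := (fun _ : 'I_1 => T i).

Let Tb i : bounded_op (T i). Proof. by have [] := hT. Qed.

Let Tbb i : bounded_below (T i).
Proof. by apply: left_invertible_bounded_below; have [] := hT. Qed.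

Let TC i j : T i \o T j = T j \o T i. Proof. by have [] := hT. Qed.

Let TCE i j x : T i (T j x) = T j (T i x).
Proof. by have /(congr1 (@^~ x)) := TC i j. Qed.

Let LC i j x : i != j -> left_inv (T i) (T j x) = T j (left_inv (T i) x).
Proof. by have [_ _ _ h] := hT; move=> /h /(congr1 (@^~ x)). Qed.

Lemma coprojC i j x : i != j -> coproj (T i) (T j x) = T j (coproj (T i) x).
Proof. by move=> ij; rewrite /coproj LC// linearB TCE. Qed.

Lemma op_ker_adjoint_invariant i j x : i != j ->
  op_ker (adjoint (T i)) x -> op_ker (adjoint (T i)) (T j x).
Proof.
move=> ij /(left_inv_eq0 (Tb i) (Tbb i)) Lx.
by apply/(left_inv_eq0 (Tb i) (Tbb i)); rewrite LC// Lx linear0.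
Qed.

(** Self-adjointness moves the projection onto [T i u], where it commutes past [T i]. *)
Lemma coproj_op_ker_adjoint i j x : i != j ->
  op_ker (adjoint (T i)) x -> op_ker (adjoint (T i)) (coproj (T j) x).
Proof.
move=> ij /(op_ker_adjointP (Tb i)) Tx; apply/(op_ker_adjointP (Tb i)) => u.
by rewrite -coproj_selfadjoint// coprojC 1?eq_sym// Tx.
Qed.

Lemma individual_wandering_propertyP : individual_wandering_property T <->
  forall i x, generated (single i) (op_ker (adjoint (T i))) x.
Proof.
have E i : \bigcap_(j in [set: 'I_1]) op_ker (adjoint (single i j)) =
    op_ker (adjoint (T i)).
  by apply/seteqP; split=> [x /(_ ord0 I)|x Tx j _].
have P i := @joint_wandering_propertyP 1 (single i) (fun=> Tb i) (fun _ _ => erefl).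
by split=> h i; have := P i; rewrite E => -[h1 h2]; [exact: h1|exact: h2].
Qed.

Lemma joint_individual :
  joint_wandering_property T -> individual_wandering_property T.
Proof.
move=> /(joint_wandering_propertyP Tb TC) WT; apply/individual_wandering_propertyP.
move=> i x; set G := generated _ _.
have Gc : closed_subspace G by exact: closed_subspace_generated.
have kerG : op_ker (adjoint (T i)) `<=` G by exact: generated_sub.
have GTi : G `<=` T i @^-1` G.
  exact: (@generated_invariant 1 (single i) (fun=> Tb i) (fun _ _ => erefl) _ ord0).
(* [G] contains [W], so once it is invariant under every [T j] it contains all that [W]
   generates. *)
suff GT j : G `<=` T j @^-1` G.
  apply: generated_subset (WT x) => // y Wy.
  by apply: kerG; exact: Wy.
have [<-//|ij] := eqVneq i j.
apply: generated_subset.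
- apply: closed_subspace_preimage => //; first exact: linearP.
  exact: bounded_op_continuous.
- by move=> y Ty; apply: kerG; exact: op_ker_adjoint_invariant.
- by move=> _ y /= Gy; rewrite TCE; exact: GTi.
Qed.

(** The product of the projections P_i over [s], with the last index applied first. *)
Let Q (s : seq 'I_n) (x : H) : H := foldr (fun i => coproj (T i)) x s.

Let Q_linear s : linear (Q s).
Proof.
by elim: s => //= i s IH a x y /=; rewrite IH; apply: coproj_linear.
Qed.

Let Q_continuous s : continuous (Q s).
Proof.
elim: s => [|i s IH] x /=; first exact: cvg_id.
apply: (@continuous_comp _ _ _ (Q s) (coproj (T i))); first exact: IH.
exact: coproj_continuous.
Qed.

Let QC s i x : i \notin s -> Q s (T i x) = T i (Q s x).
Proof.
elim: s => //= j s IH; rewrite inE negb_or => /andP[ij si].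
by rewrite IH// coprojC// eq_sym.
Qed.

(** The factor P_i lands in the kernel, and each factor applied afterwards preserves it. *)
Let Q_ker s i x : i \in s -> op_ker (adjoint (T i)) (Q s x).
Proof.
elim: s => //= j s IH; rewrite inE; have [-> _|ij /= si] := eqVneq i j.
  exact: coproj_ker.
by apply: coproj_op_ker_adjoint => //; exact: IH.
Qed.

Lemma individual_joint :
  individual_wandering_property T -> joint_wandering_property T.
Proof.
move=> /individual_wandering_propertyP ind.
apply/(joint_wandering_propertyP Tb TC); set G := generated _ _.
have Gc : closed_subspace G by exact: closed_subspace_generated.
have QG s : uniq s -> (forall x, G (Q s x)) -> forall x, G x.
  (* Induction from the right end peels off the innermost factor: [Q (rcons s i)] is [Q s] after
     P_i. *)
  elim/last_ind: s => // s i IH; rewrite rcons_uniq => /andP[si us] GQ.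
  apply: IH => // x.
  (* The preimage of [G] under [Q s] contains the kernel of T_i^*, which P_i fixes, and is stable
     under [T i] because [i] is not in [s]. *)
  apply: (@generated_subset 1 (single i) _ (Q s @^-1` G) _ _ _ x (ind i x)).
  - exact: closed_subspace_preimage.
  - move=> y Ty /=; have := GQ y; rewrite /Q foldr_rcons coproj_id//.
  - move=> _ y Gy /=; rewrite QC//; exact: generated_invariant.
apply: (QG (enum 'I_n) (enum_uniq _)) => x.
by apply: generated_sub => i _; apply: Q_ker; rewrite mem_enum.
Qed.

End LeftInverseCommuting.

End Hilbert.

Theorem theorem4p3 (R : realType) (H : hilbertType R) (n : nat)
    (T : 'I_n -> {linear H -> H}) (hT : left_inverse_commuting T) :
  (individual_wandering_property T <-> joint_wandering_property T) /\
  (joint_wandering_property T ->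
   let W := (\bigcap_i op_ker (adjoint (T i)))%classic in
   generating_wandering T W /\
   forall W' : set H, generating_wandering T W' -> W' = W).
Proof.
have [Tb _ TC _] := hT.
split; first by split; [exact: individual_joint|exact: joint_individual].
move=> /(joint_wandering_propertyP Tb TC)/(generating_wandering_bigcapP Tb TC) gen.
by split=> // W'; exact: generating_wandering_unique.
Qed.
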